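(* If the order $s$ is a negative rational number ($s\in\mathbb Q_-$) with $|s|>1$, the fractional derivative of order $s$ (in the sense of the second definition) does not have the property of linearity $$\frac{d^s(ax^\alpha+bx^\beta)}{dx^s}=a\frac{d^sx^\alpha}{dx^s}+b\frac{d^sx^\beta}{dx^s}.$$ In fact, in this case, $$\frac{d^s(ax^\alpha+bx^\beta)}{dx^s}=a\frac{d^sx^\alpha}{dx^s}+b\frac{d^sx^\beta}{dx^s}+\sum_{k=-|[s]|}^{-1}c_k\frac{x^{k-s}}{\Gamma(k-[s]+1)},$$ where the $c_k$ are constants.
   Context: Second definition. For any $(s,\alpha)\in\mathbb Q\times\mathbb R\setminus\{(-1,-1)\}$ and $x\in\mathbb R^+$, a derivative of order $s$ of the function $ax^\alpha$ (equal to $ae^{\alpha\ln x}$ for $x>0$, and at $x=0$ equal to $a$ if $\alpha=0$ and to $0$ if $\alpha\neq0$) is defined by $$\frac{d^s(ax^\alpha)}{dx^s}=a\frac{d^sx^\alpha}{dx^s}=a\frac{\Gamma(\alpha+1)}{\Gamma(\alpha-s+1)}x^{\alpha-s}+\sum_{k=-|[s]|}^{-1}c_k\frac{x^{k-s}}{\Gamma(k-[s]+1)},$$ and a derivative of order $s$ of the linear combination $ax^\alpha+bx^\beta$ is $$a\frac{\Gamma(\alpha+1)}{\Gamma(\alpha-s+1)}x^{\alpha-s}+b\frac{\Gamma(\beta+1)}{\Gamma(\beta-s+1)}x^{\beta-s}+\sum_{k=-|[s]|}^{-1}c_k\frac{x^{k-s}}{\Gamma(k-[s]+1)}.$$ In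 each such expression the $c_k$ are arbitrary constants (a different set for each derivative in general), and $[s]$ is the entire part of $s$ (truncation toward zero). Here $\Gamma$ is the gamma function, and $1/\Gamma$ is taken to be $0$ at the poles of $\Gamma$. *)

(* Defs.v *)
From HB Require Import structures.
From mathcomp Require Import all_boot all_order all_algebra.
From mathcomp Require Import all_classical all_reals all_analysis.

Set Implicit Arguments.
Unset Strict Implicit.
Unset Printing Implicit Defensive.

Import Order.TTheory GRing.Theory Num.Theory.
Import numFieldNormedType.Exports.

Local Open Scope classical_set_scope.
Local Open Scope ring_scope.

Definition euler_integral (R : realType) (z : R) : R :=
  Rintegral lebesgue_measure `]0, +oo[ (fun t : R => t `^ (z - 1) * expR (- t)).

(* The number of applications of Gamma(z) = Gamma(z + 1) / z that bring the
   argument into the half-line where Euler's integral converges. *)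
Definition Gamma_shift (R : realType) (z : R) : nat :=
  if 0 < z then 0%N else `|Num.floor z|%N.+1.

(* At z = 0, -1, -2, ... the product below vanishes; since 0^-1 = 0,
   Gamma z = 0 and (Gamma z)^-1 = 0 there, the latter being the usual
   convention for 1 / Gamma at a pole. *)
Definition Gamma (R : realType) (z : R) : R :=
  euler_integral (z + (Gamma_shift z)%:R) /
    \prod_(i < Gamma_shift z) (z + i%:R).

Definition Gamma_pole (R : realType) (z : R) : bool :=
  (z <= 0) && (z \is a Num.int).

(* Gamma(alpha + 1) / Gamma(alpha - s + 1).  When alpha + 1 is a pole the
   quotient is read as its limiting value (as in d(x^-1)/dx = - x^-2); if
   moreover alpha - s + 1 is not a pole there is no finite limit, and lim
   returns an unspecified real. *)
Definition Gamma_ratio (R : realType) (s : rat) (alpha : R) : R :=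
  if Gamma_pole (alpha + 1)
  then lim (Gamma (y + 1) / Gamma (y - ratr s + 1) @[y --> alpha^'])
  else Gamma (alpha + 1) / Gamma (alpha - ratr s + 1).

Definition entire_part (s : rat) : int :=
  if 0 <= s then Num.floor s else Num.ceil s.

(* The sum over k = -|[s]|, ..., -1, reindexed by k = j - |[s]|. *)
Definition const_sum (R : realType) (s : rat) (c : int -> R) (x : R) : R :=
  \sum_(j < `|entire_part s|%N)
    let k : int := j%:Z - `|entire_part s|%N%:Z in
    c k * (x `^ (k%:~R - ratr s) / Gamma ((k - entire_part s + 1)%:~R : R)).

(* The set of derivatives of order s of a x^alpha on the half-line x >= 0,
   one for each choice of the arbitrary constants.  powR satisfies
   0 `^ 0 = 1 and 0 `^ alpha = 0 for alpha != 0. *)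
Definition fracder_monomial (R : realType) (s : rat) (a alpha : R) :
    set (R -> R) :=
  [set D | ~ (s = -1 /\ alpha = -1) /\
    exists c : int -> R, forall x : R, 0 <= x ->
      D x = a * Gamma_ratio s alpha * x `^ (alpha - ratr s) + const_sum s c x].

Definition fracder_combination (R : realType) (s : rat) (a alpha b beta : R) :
    set (R -> R) :=
  [set D | [/\ ~ (s = -1 /\ alpha = -1), ~ (s = -1 /\ beta = -1) &
    exists c : int -> R, forall x : R, 0 <= x ->
      D x = a * Gamma_ratio s alpha * x `^ (alpha - ratr s)
          + b * Gamma_ratio s beta * x `^ (beta - ratr s) + const_sum s c x]].

(* The constants occurring in the three derivatives are independent of each
   other, so linearity is asserted for every choice of the derivatives. *)
Definition fracder_linear (R : realType) (s : rat) (a alpha b beta : R) : Prop :=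
  forall D D1 D2 : R -> R,
    fracder_combination s a alpha b beta D ->
    fracder_monomial s 1 alpha D1 ->
    fracder_monomial s 1 beta D2 ->
    forall x : R, 0 <= x -> D x = a * D1 x + b * D2 x.

(* Main.v *)
Require Import Defs.
From mathcomp Require Import all_boot all_order all_algebra.
From mathcomp Require Import all_classical all_reals all_analysis.
From mathcomp Require Import measurable_realfun ring.

Import Order.TTheory GRing.Theory Num.Theory.
Import numFieldNormedType.Exports.

Local Open Scope classical_set_scope.
Local Open Scope ring_scope.

(** The derivatives of order [s] of a function form a coset of the vector
    space of all functions [const_sum s c] on [x >= 0], because
    [const_sum s c] is linear in the family [c] ([const_sumD],
    [const_sumZ]).  Hence the constants of
    the derivatives of the two monomials can be absorbed into those of the
    derivative of the combination, or subtracted from them, which is the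
    corrected formula with one extra sum.

    Linearity without the extra sum would force this vector space to vanish:
    the three derivatives may be taken with constants [0], [0] and [c], and
    then [const_sum s c] has to be zero for every [c].  As [s < -1], the
    integer [entire_part s] is a negative [- N], so the sum ranges over a
    nonempty set of indices; its first term, of index [k = - N], is
    [c_k x^(k - s) / Gamma 1], and [Gamma 1 = 1].  Taking [c] to be the
    indicator of that index and [x = 1] gives the value [1]
    ([const_sum_first_at1]). *)

(** Euler's integral at [1] is the total mass of the exponential law of
    rate [1]. *)
Lemma euler_integral1 (R : realType) : euler_integral (1 : R) = 1.
Proof.
rewrite /euler_integral /Rintegral -[RHS]/(fine 1%:E); congr fine.
rewrite -(integral_exponential_pdf (ltr01 : 0 < (1 : R))).
under eq_integral do rewrite subrr powRr0 mul1r.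
rewrite integral_itv_obnd_cbnd; last first.
  apply/measurable_EFinP/measurable_funTS.
  by apply: measurableT_comp => //; exact: measurable_funN.
rewrite integral_mkcond; apply: eq_integral => x _.
rewrite /exponential_pdf !patchE; case: ifP => // _.
by rewrite mul1r mulN1r.
Qed.

Lemma Gamma1 (R : realType) : Gamma (1 : R) = 1.
Proof.
by rewrite /Gamma /Gamma_shift ltr01 big_ord0 addr0 euler_integral1 divr1.
Qed.

Lemma const_sumD (R : realType) (s : rat) (c c' : int -> R) (x : R) :
  const_sum s (fun k => c k + c' k) x = const_sum s c x + const_sum s c' x.
Proof.
by rewrite /const_sum -big_split; apply: eq_bigr => j _; exact: mulrDl.
Qed.

Lemma const_sumZ (R : realType) (s : rat) (t : R) (c : int -> R) (x : R) :
  const_sum s (fun k => t * c k) x = t * const_sum s c x.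
Proof.
by rewrite /const_sum mulr_sumr; apply: eq_bigr => j _; exact/esym/mulrA.
Qed.

Lemma const_sum0 (R : realType) (s : rat) (x : R) :
  const_sum s (fun=> 0) x = 0.
Proof. by apply: big1 => j _; rewrite /= mul0r. Qed.

Lemma entire_part_lt0 (s : rat) : s <= -1 -> entire_part s < 0.
Proof.
move=> s1; rewrite /entire_part leNgt (le_lt_trans s1) ?ltrN10 //=.
by rewrite ceil_lt0.
Qed.

(** For a negative [entire_part s] the lowest index of the sum is
    [entire_part s] itself, where the argument of [Gamma] is [1]; at [x = 1]
    the power of [x] drops out. *)
Lemma const_sum_first_at1 (R : realType) (s : rat) : s <= -1 ->
  const_sum s (fun k => (k == entire_part s)%:R) (1 : R) = 1.
Proof.
move=> /entire_part_lt0; rewrite /const_sum.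
case: (entire_part s) => // n _; rewrite [absz _]/= NegzE big_ord_recl /=.
rewrite sub0r eqxx mul1r powR1 addNr add0r Gamma1 invr1 mulr1.
rewrite big1 ?addr0 // => j _.
by rewrite /bump /= add1n -subr_eq0 opprK subrK mul0r.
Qed.

Theorem theorem4p8 (R : realType) (s : rat) (s_neg : s < 0) (s_gt1 : 1 < `|s|)
    (a alpha b beta : R) :
  ~ fracder_linear s a alpha b beta /\
  (forall D1 D2 : R -> R,
     fracder_monomial s 1 alpha D1 ->
     fracder_monomial s 1 beta D2 ->
     forall D : R -> R,
       fracder_combination s a alpha b beta D <->
       exists c : int -> R, forall x : R, 0 <= x ->
         D x = a * D1 x + b * D2 x + const_sum s c x).
Proof.
have s_ltN1 : s < -1 by rewrite ltrNr -(ltr0_norm s_neg).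
have not_excluded (e : R) : ~ (s = -1 /\ e = -1).
  by case=> sN1 _; rewrite sN1 ltxx in s_ltN1.
split=> [lin|D1 D2 [_ [c1 D1E]] [_ [c2 D2E]] D].
  pose main (e x : R) := Gamma_ratio s e * x `^ (e - ratr s).
  pose delta (k : int) : R := (k == entire_part s)%:R.
  pose D x := a * main alpha x + b * main beta x + const_sum s delta x.
  have main_der e : fracder_monomial s 1 e (main e).
    split=> //; exists (fun=> 0) => x _.
    by rewrite const_sum0 addr0 mul1r.
  have D_der : fracder_combination s a alpha b beta D.
    by split=> //; exists delta => x _; rewrite /D /main !mulrA.
  have /eqP := lin _ _ _ D_der (main_der alpha) (main_der beta) 1 ler01.
  rewrite /D const_sum_first_at1 ?(ltW s_ltN1) //.
  by rewrite -subr_eq0 addrAC subrr add0r oner_eq0.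
split=> [[_ _ [c DE]]|[c DE]].
  exists (fun k => c k + (- a * c1 k + - b * c2 k)) => x x0.
  by rewrite DE // D1E // D2E // !const_sumD !const_sumZ; ring.
split=> //; exists (fun k => c k + (a * c1 k + b * c2 k)) => x x0.
by rewrite DE // D1E // D2E // !const_sumD !const_sumZ; ring.
Qed.
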